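(* For every $\alpha\in[m,M]$ (where $m=\inf_{n\ge1}b_n$, $M=\sup_{n\ge1}b_n$), the limit \[ L(\alpha)=\lim_{x\to+\infty}\frac{1}{\ln x}\sum_{\substack{1\le n\le x\\ b_n\le\alpha}}\frac1n \] exists and equals \[ L(\alpha)=\frac{1}{\ln s}\int_{E_\alpha}\frac{dx}{x},\qquad E_\alpha=\{x\in[s^{-1},1):\ \lambda(x)\le\alpha\}, \] the integral being a Lebesgue integral.
   Context: Fix integers $p\ge 3$ and $2\le s<p$, and a set $A\subset\{0,1,\dots,p-1\}$ with $\#A=s$. Let $h:\{0,1,\dots,s-1\}\to A$ be the unique strictly increasing bijection. For a positive integer $n$ with base-$s$ expansion $n=\sum_{i=0}^k\varepsilon_i s^i$ ($\varepsilon_i\in\{0,\dots,s-1\}$, $\varepsilon_k\ne 0$), put $a_n=\sum_{i=0}^k h(\varepsilon_i)p^i$, and put $a_0=h(0)$. Let $b_n=a_n/n^{\log_s p}$ for $n\ge1$. For real $x\ge0$ let $a(x)=a_{\lfloor x\rfloor}$, and for $x>0$ let $\lambda(x)=\lim_{k\to\infty}\frac{a(s^kx)}{(s^kx)^{\log_s p}}$ (this limit exists for every $x>0$). *)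

(* Defs.v *)
From HB Require Import structures.
From mathcomp Require Import all_boot all_order all_algebra.
From mathcomp Require Import all_classical all_reals all_analysis.
Unset Printing Implicit Defensive.
Import Order.TTheory GRing.Theory Num.Theory.
Import numFieldNormedType.Exports.
Local Open Scope classical_set_scope.
Local Open Scope ring_scope.

Section Defs.
Variables (p s : nat) (A : {set 'I_p}).

Definition hA (i : nat) : nat := nth 0%N (sort leq [seq val x | x <- enum A]) i.

Definition aseq (n : nat) : nat :=
  if n == 0%N then hA 0
  else (\sum_(i < (trunc_log s n).+1) hA ((n %/ s ^ i) %% s) * p ^ i)%N.

Variable R : realType.

Definition expo : R := ln (p%:R) / ln (s%:R).

Definition bseq (n : nat) : R := (aseq n)%:R / (n%:R `^ expo).

Definition areal (x : R) : R := (aseq (Num.truncn x))%:R.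

Definition lambda (x : R) : R :=
  limn (fun k : nat => areal ((s%:R) ^+ k * x) / (((s%:R) ^+ k * x) `^ expo)).

Definition m_inf : R := inf [set bseq n | n in [set n : nat | (0 < n)%N]].
Definition M_sup : R := sup [set bseq n | n in [set n : nat | (0 < n)%N]].

Definition partialL (alpha x : R) : R :=
  (ln x)^-1 * \sum_(1 <= n < (Num.truncn x).+1 | bseq n <= alpha) (n%:R)^-1.

Definition Eset (alpha : R) : set R :=
  [set x | (s%:R)^-1 <= x /\ x < 1 /\ lambda x <= alpha].

End Defs.

(* Main.v *)
(** For [s^-1 <= x < 1] and [k >= 1] put [u_k = a(s^k x) / p^k]. Appending a
    base-[s] digit sends [a_n] to [p a_n + h(d)] with [0 <= h(d) < p], so [u_k]
    increases and [u_k + p^-k] decreases; hence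
    [u_k <= lambda(x) x^theta <= u_k + p^-k] with [theta = log_s p].

    The level set [lambda = alpha] is null: on each of the cells
    [floor(s^k x) = n], [n < s^k], the quantity [alpha x^theta] is confined to an
    interval of length [p^-k], so the part of the level set in the cell has
    diameter [O(p^-k)], and [s^k p^-k --> 0].

    The sum of [1/n] over [s^k <= n < s^(k+1)] with [b_n <= alpha] is the integral
    over [[s^-1, 1)] of a step function bounded by [s], which converges to
    [x^-1] on [E_alpha] and to [0] elsewhere, off the level set. By dominated
    convergence these block sums converge to the integral of [x^-1] over
    [E_alpha], and Cesaro averaging over the blocks gives the logarithmic mean. *)
Require Import Defs.
From HB Require Import structures.
From mathcomp Require Import all_boot all_order all_algebra.
From mathcomp Require Import all_classical all_reals all_analysis.
From mathcomp Require Import measurable_realfun.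
From mathcomp Require Import zify ring lra.
Import Order.TTheory GRing.Theory Num.Theory.
Import numFieldNormedType.Exports.
Local Open Scope classical_set_scope.
Local Open Scope ring_scope.
Set Implicit Arguments.
Unset Strict Implicit.

(** * Digit substitution on the integers *)

Section DigitSubstitution.
Variables (p s : nat) (A : {set 'I_p}).
Hypotheses (hs : (2 <= s)%N) (hsp : (s < p)%N) (hA : #|A| = s).

Local Notation h := (Defs.hA p A).
Local Notation a := (aseq p s A).

Lemma size_digits : size (sort leq [seq val x | x <- enum A]) = s.
Proof. by rewrite size_sort size_map -cardE. Qed.

Lemma digit_lt (d : nat) : (h d < p)%N.
Proof.
rewrite /Defs.hA; have [ltds|] := ltnP d s; last first.
  (* Beyond the end of the list [nth] returns its default [0], which is below [p]. *)
  by move=> le; rewrite nth_default ?size_digits// (leq_ltn_trans _ hsp).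
have : nth 0%N (sort leq [seq val x | x <- enum A]) d \in
    sort leq [seq val x | x <- enum A] by rewrite mem_nth// size_digits.
by rewrite mem_sort => /mapP[x _ ->]; exact: ltn_ord.
Qed.

(** The sorted list has no repetition, so [h] is strictly increasing on digits and a nonzero digit
    has an image above [h 0]. *)
Lemma digit_gt0 (d : nat) : (0 < d < s)%N -> (0 < h d)%N.
Proof.
move=> /andP[d0 ds]; rewrite /Defs.hA (leq_ltn_trans (leq0n (h 0)))//.
apply: (@sorted_ltn_nth _ ltn ltn_trans) => //; rewrite ?inE ?size_digits//; last lia.
by rewrite ltn_sorted_uniq_leq sort_uniq map_inj_uniq ?enum_uniq ?sort_sorted//.
Qed.

Lemma aseq_small (d : nat) : (d < s)%N -> a d = h d.
Proof.
move=> ds; rewrite /aseq; case: eqP => [->//|/eqP d0].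
rewrite (@trunc_log_eq s 0 d) ?big_ord_recl ?big_ord0 ?expn0 ?divn1 ?modn_small//.
  by rewrite addn0 muln1.
by rewrite expn1 ds lt0n d0.
Qed.

(** Appending a digit moves all the others one place up. Positivity of [n] matters: [a 0] is [h 0],
    which may be nonzero, whereas a leading zero contributes nothing to [a d]. *)
Lemma aseq_rec (n d : nat) : (0 < n)%N -> (d < s)%N ->
  a (n * s + d)%N = (p * a n + h d)%N.
Proof.
move=> n0 ds; rewrite /aseq.
have -> : (n * s + d == 0)%N = false by apply/eqP; nia.
have -> : (n == 0)%N = false by apply/eqP; lia.
have -> : trunc_log s (n * s + d) = (trunc_log s n).+1.
  apply: trunc_log_eq => //; have /andP[] := @trunc_log_bounds s n hs n0.
  by rewrite !(expnS s); set u := (_ ^ _)%N; nia.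
rewrite big_ord_recl expn0 divn1 muln1 modnMDl modn_small// addnC; congr addn.
rewrite big_distrr; apply: eq_bigr => i _ /=.
rewrite /bump /= add1n !expnS divnMA divnMDl; last by lia.
by rewrite (divn_small ds) addn0 mulnCA.
Qed.

(** The leading digit is nonzero, hence so is its image; the induction strips the last digit until
    only the leading one is left. *)
Lemma aseq_gt0 (n : nat) : (0 < n)%N -> (0 < a n)%N.
Proof.
have [k] := ubnP n; elim: k n => // k IH n nk n0.
have [ns|sn] := ltnP n s; first by rewrite aseq_small// digit_gt0// n0.
rewrite (divn_eq n s) aseq_rec ?ltn_pmod//; [|by rewrite divn_gt0//; lia|lia].
have : (n %/ s < n)%N by rewrite ltn_Pdiv.
have : (0 < n %/ s)%N by rewrite divn_gt0//; lia.
by move=> q0 qn; have := IH (n %/ s)%N ltac:(lia) q0; nia.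
Qed.

End DigitSubstitution.

(** * Existence and two-sided bounds of the limit function *)

Section LimitFunction.
Variables (R : realType) (p s : nat) (A : {set 'I_p}).
Hypotheses (hs : (2 <= s)%N) (hsp : (s < p)%N) (hA : #|A| = s).

Local Notation theta := (expo p s R).
Local Notation lam := (lambda p s A R).
Local Notation approx k x := (areal p s A R (s%:R ^+ k * x) / p%:R ^+ k).

Let s0 : 0 < s%:R :> R. Proof. by rewrite ltr0n ltnW. Qed.
Let p0 : 0 < p%:R :> R. Proof. by rewrite ltr0n (leq_ltn_trans _ hsp). Qed.
Let s1 : 1 < s%:R :> R. Proof. by rewrite ltr1n. Qed.

Lemma ln_base_gt0 : 0 < ln (s%:R : R). Proof. exact: ln_gt0. Qed.

Lemma expo_ge1 : 1 <= theta.
Proof.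
rewrite /expo ler_pdivlMr ?ln_base_gt0// mul1r ler_ln ?posrE//.
by rewrite ler_nat ltnW.
Qed.

Lemma powR_base_expo : s%:R `^ theta = p%:R :> R.
Proof.
rewrite /powR gt_eqF// /expo divfK ?gt_eqF ?ln_base_gt0//.
by rewrite lnK// posrE.
Qed.

Lemma powR_scale (k : nat) (x : R) : 0 <= x ->
  (s%:R ^+ k * x) `^ theta = p%:R ^+ k * x `^ theta.
Proof.
move=> x0; rewrite powRM ?exprn_ge0//.
by rewrite -powR_mulrn// powRAC powR_base_expo powR_mulrn.
Qed.

(** Scaling by [s] appends one base-[s] digit to the integer part, which brings [areal] within reach
    of [aseq_rec]. *)
Lemma truncn_mulS (x : R) : 0 <= x ->
  exists2 d, (d < s)%N & Num.truncn (s%:R * x) = (Num.truncn x * s + d)%N.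
Proof.
move=> x0; have sx0 : 0 <= s%:R * x by rewrite mulr_ge0.
set m := Num.truncn x; set n := Num.truncn _.
have /andP[mx xm] := truncn_itv x0; have /andP[nx xn] := truncn_itv sx0.
have mn : (m * s <= n)%N.
  by rewrite /n truncn_ge_nat// natrM mulrC ler_wpM2l.
have nm : (n < m.+1 * s)%N.
  by rewrite /n truncn_lt_nat// natrM mulrC ltr_pM2r.
by exists (n - m * s)%N; lia.
Qed.

Section Approx.
Variable x : R.
Hypothesis sx : s%:R^-1 <= x.

Let x0 : 0 < x. Proof. by rewrite (lt_le_trans _ sx)// invr_gt0. Qed.

(** At exponent [0] the integer part of [x] may vanish, and [aseq_rec] does not cover that case;
    this is why the approximants below start at index [1]. *)
Lemma expM_ge1 (k : nat) : 1 <= s%:R ^+ k.+1 * x.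
Proof.
have sx1 : 1 <= s%:R * x by rewrite -ler_pdivrMl// mulr1.
by rewrite exprSr -mulrA mulr_ege1// exprn_ege1// ltW.
Qed.

(** The new digit [d] adds [h d / p^(k+2)]. This is nonnegative, and [h d + 1 <= p] keeps it within
    [p^-(k+1) - p^-(k+2)]. *)
Lemma approx_step (k : nat) : approx k.+1 x <= approx k.+2 x /\
  approx k.+2 x + p%:R ^- k.+2 <= approx k.+1 x + p%:R ^- k.+1.
Proof.
rewrite /areal [in X in _ <= X / _]exprS -mulrA.
have y1 := expM_ge1 k; set y := s%:R ^+ k.+1 * x in y1 *.
have [d ds ->] := truncn_mulS (le_trans ler01 y1).
rewrite aseq_rec ?truncn_gt0// natrD natrM [p%:R ^+ k.+2]exprS invfM mulrDl.
rewrite mulrACA divff ?gt_eqF// mul1r.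
have dp : (Defs.hA p A d)%:R + 1 <= p%:R :> R by rewrite natr1 ler_nat (digit_lt hsp hA).
set q := p%:R ^- k.+1; have q0 : 0 < q by rewrite invr_gt0 exprn_gt0.
split; first by rewrite lerDl !mulr_ge0 ?invr_ge0 ?ler0n // ltW.
rewrite -addrA lerD2l mulrA -mulrDl ger_pMl//.
by rewrite -[X in _ + X]mul1r -mulrDl ler_pdivrMr// mul1r.
Qed.

Lemma approx_mono (j k : nat) : (j <= k)%N -> approx j.+1 x <= approx k.+1 x /\
  approx k.+1 x + p%:R ^- k.+1 <= approx j.+1 x + p%:R ^- j.+1.
Proof.
move=> /subnKC <-; elim: (k - j)%N => [|i [IH1 IH2]]; first by rewrite addn0.
rewrite addnS; have [step1 step2] := approx_step (j + i).
by split; [exact: le_trans step1|exact: le_trans IH2].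
Qed.

(** Since [s^theta = p], the denominator splits into [p^k] and the fixed factor [x^theta], so the
    monotonicity of [approx] carries over to the ratio. *)
Lemma ratio_approx (k : nat) :
  areal p s A R (s%:R ^+ k * x) / (s%:R ^+ k * x) `^ theta =
  approx k x / x `^ theta.
Proof. by rewrite powR_scale ?ltW// invfM mulrA. Qed.

Lemma is_cvg_approx : cvgn (fun k => approx k.+1 x).
Proof.
apply: nondecreasing_is_cvgn => [j k /approx_mono[]//|].
exists (approx 1 x + p%:R ^- 1) => _ [k _ <-].
have [_] := approx_mono (leq0n k); apply: le_trans.
by rewrite lerDl invr_ge0 exprn_ge0.
Qed.

(** [lambda] is defined by [limn], whose value is informative only once convergence is proved. *)
Lemma cvg_lambda : (fun k => areal p s A R (s%:R ^+ k * x) /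
  (s%:R ^+ k * x) `^ theta) @ \oo --> lam x.
Proof.
rewrite /lambda; under eq_fun do rewrite ratio_approx.
have cv : approx k x @[k --> \oo] --> limn (fun k => approx k.+1 x).
  by rewrite -cvg_shiftS; exact: is_cvg_approx.
exact: (cvgP _ (cvgM cv (cvg_cst (x `^ theta)^-1))).
Qed.

(** Both inequalities of [approx_mono] pass to the limit. The width [p^-(k+1)] of the enclosure is
    the quantitative input for the level sets. *)
Lemma approx_lambda (k : nat) :
  approx k.+1 x <= lam x * x `^ theta <= approx k.+1 x + p%:R ^- k.+1.
Proof.
have xt0 : 0 < x `^ theta by rewrite powR_gt0.
have cv : approx k.+1 x @[k --> \oo] --> lam x * x `^ theta.
  have := cvg_lambda; rewrite -cvg_shiftS.
  under eq_fun do rewrite ratio_approx.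
  move=> /cvgM /(_ (cvg_cst (x `^ theta))); apply: cvg_trans.
  by apply: near_eq_cvg; apply: nearW => i /=; rewrite divfK ?gt_eqF.
apply/andP; split.
  apply: (cvgr_to_ge cv); exists k => // j /= kj.
  by have [] := approx_mono kj.
apply: (cvgr_to_le cv); exists k => // j /= kj.
have [_] := approx_mono kj; apply: le_trans.
by rewrite lerDl invr_ge0 exprn_ge0.
Qed.

(** The first approximant is already positive, because [s * x >= 1]. *)
Lemma lambda_gt0 : 0 < lam x.
Proof.
have /andP[+ _] := approx_lambda 0.
rewrite -(pmulr_lgt0 _ (powR_gt0 theta x0)); apply: lt_le_trans.
rewrite divr_gt0 ?exprn_gt0// ltr0n (aseq_gt0 hs hsp hA)//.
by rewrite truncn_gt0 expM_ge1.
Qed.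

End Approx.
End LimitFunction.

(** * Measurability of integer parts, and measure against diameter *)

Lemma measurable_fun_truncn (R : realType) (phi : nat -> R) :
  measurable_fun [set: R] (fun x => phi (Num.truncn x)).
Proof.
move=> _ B mB; rewrite setTI.
have -> : (fun x => phi (Num.truncn x)) @^-1` B =
    \bigcup_(n in [set n | B (phi n)]) [set x : R | Num.truncn x = n].
  apply/seteqP; split=> [x Bx|x [n Bn /= xn]]; first by exists (Num.truncn x).
  by rewrite /preimage /= xn.
apply: bigcup_measurable => -[|n] _.
  (* The fibre over [0] is a whole ray, since [truncn] sends negative numbers to [0]. *)
  rewrite (_ : mkset _ = [set` `]-oo, 1%:R[ : interval R]).
    exact: measurable_itv.
  apply/seteqP; split=> x /=; rewrite in_itv/= -truncn_le_nat.
    by move=> ->.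
  by rewrite leqn0 => /eqP.
rewrite (_ : mkset _ = [set` `[n.+1%:R, n.+2%:R[ : interval R]).
  exact: measurable_itv.
apply/seteqP; split=> x /=; rewrite in_itv/= -truncn_gt_nat -truncn_le_nat.
  by move=> ->; rewrite !leqnn.
by move=> /andP[nx xn]; apply/eqP; rewrite eqn_leq xn nx.
Qed.

(** The set lies in the closed interval of radius [r] around any of its points. The factor 2 lost
    this way is harmless, as the bound is only used to tend to zero. *)
Lemma lebesgue_measure_le_diam (R : realType) (S : set R) (r : R) :
  measurable S -> 0 <= r -> {in S &, forall x y, x <= y -> y - x <= r} ->
  (lebesgue_measure S <= (r *+ 2)%:E)%E.
Proof.
move=> mS r0 diamS; have [->|/set0P[x Sx]] := eqVneq S set0.
  by rewrite measure0 lee_fin mulrn_wge0.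
have mI : measurable (`[x - r, x + r]%classic : set R) by exact: measurable_itv.
apply: (@le_trans _ _ (lebesgue_measure (`[x - r, x + r]%classic : set R))).
  apply: le_measure; rewrite ?inE// => y Sy /=; rewrite in_itv/=.
  have [xy|yx] := leP x y.
    have := diamS _ _ (mem_set Sx) (mem_set Sy) xy; lra.
  have := diamS _ _ (mem_set Sy) (mem_set Sx) (ltW yx); lra.
rewrite lebesgue_measure_itv/= lte_fin; case: ifP => _; rewrite lee_fin.
  by rewrite mulr2n; lra.
by rewrite mulrn_wge0.
Qed.

(** * Measurability and nullity of the level sets *)

Section LevelSets.
Variables (R : realType) (p s : nat) (A : {set 'I_p}).
Hypotheses (hs : (2 <= s)%N) (hsp : (s < p)%N) (hA : #|A| = s).

Local Notation theta := (expo p s R).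
Local Notation lam := (lambda p s A R).
Local Notation D := (`[s%:R^-1, 1[%classic : set R).

Let s0 : 0 < s%:R :> R. Proof. by rewrite ltr0n ltnW. Qed.
Let p0 : 0 < p%:R :> R. Proof. by rewrite ltr0n (leq_ltn_trans _ hsp). Qed.

Lemma measurable_lambda : measurable_fun D lam.
Proof.
apply: (@measurable_fun_cvg _ _ R D (fun k x =>
    areal p s A R (s%:R ^+ k * x) / (s%:R ^+ k * x) `^ theta)).
  move=> k; apply: measurable_funTS.
  have mk : measurable_fun [set: R] (fun x : R => s%:R ^+ k * x).
    by apply: measurable_funM => //; exact: measurable_cst.
  apply: measurable_funM.
    exact: (measurableT_comp
      (measurable_fun_truncn (fun n => (aseq p s A n)%:R : R)) mk).
  under eq_fun do rewrite -powRN.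
  exact: (measurableT_comp (measurable_powR (- theta)) mk).
by move=> x; rewrite /= in_itv/= => /andP[sx _]; apply: cvg_lambda.
Qed.

Lemma measurable_Eset (alpha : R) : measurable (Eset p s A R alpha).
Proof.
rewrite (_ : Eset _ _ _ _ _ = D `&` lam @^-1` `]-oo, alpha]).
  by apply: measurable_lambda => //; exact: measurable_itv.
apply/seteqP; split=> x; rewrite /Eset /= !in_itv/=.
  by move=> [-> [-> ->]].
by move=> [/andP[-> ->] ->].
Qed.

(* Bernoulli for [y / x >= 1], together with [x `^ theta >= p^-1]. *)
Lemma powR_expansion (x y : R) : s%:R^-1 <= x -> x < 1 -> x <= y ->
  y - x <= p%:R * (y `^ theta - x `^ theta).
Proof.
move=> sx x1 xy; have x0 : 0 < x by rewrite (lt_le_trans _ sx)// invr_gt0.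
have t1 := expo_ge1 R hs hsp.
have yx1 : 1 <= y / x by rewrite ler_pdivlMr// mul1r.
have yE : y `^ theta = (y / x) `^ theta * x `^ theta.
  by rewrite -powRM ?(ltW x0) ?(le_trans ler01 yx1)// divfK ?gt_eqF.
have le1 : y / x <= (y / x) `^ theta by exact: le1r_powR.
(* This is where the constant [p] arises: [p^-1] is the value of the power function at [s^-1], the
   left end of [D]. *)
have le2 : p%:R^-1 <= x `^ theta.
  rewrite (_ : p%:R^-1 = s%:R^-1 `^ theta); last first.
    rewrite -(powR_inv1 (ltW s0)) powRAC (powR_base_expo R hs hsp).
    by rewrite powR_inv1 ?ltW.
  by apply: (ge0_ler_powR (le_trans ler01 t1));
    rewrite ?nnegrE ?invr_ge0 ?(ltW s0) ?(ltW x0).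
rewrite yE -[X in _ * (_ - X)]mul1r -mulrBl mulrCA.
have p1 : 1 <= p%:R * x `^ theta by rewrite -ler_pdivrMl// mulr1.
have le3 : y - x <= y / x - 1.
  have -> : y / x - 1 = (y - x) / x by rewrite mulrBl divff ?gt_eqF.
  by rewrite ler_pdivlMr// ler_piMr ?subr_ge0// ltW.
rewrite (le_trans le3)// (le_trans (y := (y / x) `^ theta - 1)) ?lerD2r//.
by rewrite ler_peMr// subr_ge0 (le_trans yx1).
Qed.

Local Notation level alpha := (D `&` lam @^-1` [set alpha]).

Lemma measurable_level (alpha : R) : measurable (level alpha).
Proof. by apply: measurable_lambda => //; exact: measurable_itv. Qed.

(* In such a cell [lam x * x `^ theta] is known up to [p^-(k.+1)], and [lam x]
   is the constant [alpha]. *)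
Lemma level_cell_diam (alpha : R) (k n : nat) : 0 < alpha ->
  {in level alpha `&` [set x | Num.truncn (s%:R ^+ k.+1 * x) = n] &,
    forall x y, x <= y -> y - x <= p%:R ^- k / alpha}.
Proof.
move=> alpha0 x y; rewrite !inE /= !in_itv/=.
move=> [[/andP[sx x1] lx] nx] [[/andP[sy _] ly] ny] xy.
apply: (le_trans (powR_expansion sx x1 xy)).
have /andP[+ _] := approx_lambda hs hsp hA sx k.
have /andP[_] := approx_lambda hs hsp hA sy k.
rewrite /areal nx ny lx ly ler_pdivlMr// => le1 le2.
have -> : p%:R ^- k = p%:R * p%:R ^- k.+1 :> R.
  by rewrite exprS invfM mulVKf ?gt_eqF.
rewrite -mulrA ler_pM2l// mulrC mulrBr; lra.
Qed.

Lemma measurable_cell (k n : nat) :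
  measurable [set x : R | Num.truncn (s%:R ^+ k * x) = n].
Proof.
have mk : measurable_fun [set: R] (fun x : R => s%:R ^+ k * x).
  by apply: measurable_funM => //; exact: measurable_cst.
have mt := measurableT_comp
  (measurable_fun_truncn (fun i => i%:R : R)) mk.
have := mt measurableT [set n%:R] (measurable_set1 _).
rewrite setTI; congr measurable; apply/seteqP; split=> x /=.
  by move=> /eqP; rewrite eqr_nat => /eqP.
by move=> ->.
Qed.

(** On [D] the integer part of [s^(k+1) * x] is below [s^(k+1)], so that many cells suffice; each
    has measure at most twice the diameter bound [p^-k / alpha]. *)
Lemma level_measure_le (alpha : R) (k : nat) : 0 < alpha ->
  (lebesgue_measure (level alpha) <=
    ((s%:R / alpha) *+ 2 * (s%:R / p%:R) ^+ k)%:E)%E.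
Proof.
move=> alpha0.
pose cell n := level alpha `&` [set x | Num.truncn (s%:R ^+ k.+1 * x) = n].
have mcell n : measurable (cell n).
  by apply: measurableI; [exact: measurable_level|exact: measurable_cell].
have e0 : 0 <= p%:R ^- k / alpha by rewrite divr_ge0 ?invr_ge0 ?exprn_ge0 ?ltW.
apply: (@le_trans _ _ (\sum_(n < s ^ k.+1) lebesgue_measure (cell n))%E).
  apply: (@content_subadditive _ _ _ (@lebesgue_measure R) (level alpha)
    cell (s ^ k.+1)%N).
  - by move=> n _; exact: mcell.
  - exact: measurable_level.
  move=> x lx; rewrite -bigcup_mkord; exists (Num.truncn (s%:R ^+ k.+1 * x)) => //=.
  case: lx; rewrite /= in_itv/= => /andP[sx x1] _.
  have x0 : 0 <= x by rewrite (le_trans _ sx)// invr_ge0 ltW.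
  rewrite truncn_lt_nat; last by rewrite mulr_ge0 ?exprn_ge0 ?(ltW s0).
  by rewrite natrX gtr_pMr// exprn_gt0.
apply: (@le_trans _ _
    (\sum_(n < s ^ k.+1) ((p%:R ^- k / alpha) *+ 2)%:E)%E).
  apply: lee_sum => n _.
  by apply: lebesgue_measure_le_diam => //; exact: (@level_cell_diam alpha k n alpha0).
rewrite sumEFin lee_fin sumr_const card_ord -[leLHS]mulr_natl natrX.
rewrite expr_div_n exprS !mulr2n le_eqVlt.
by apply/orP; left; apply/eqP; ring.
Qed.

(** For [alpha <= 0] the level set is empty by [lambda_gt0]. Otherwise the bound above is geometric
    in [k], with ratio [s / p < 1]. *)
Lemma level_null (alpha : R) : lebesgue_measure (level alpha) = 0%E.
Proof.
have [alpha0|alpha0] := leP alpha 0.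
  rewrite (_ : level alpha = set0) ?measure0//; apply/seteqP; split=> // x /=.
  rewrite in_itv/= => -[/andP[sx _] lx].
  by have := lambda_gt0 hs hsp hA sx; rewrite lx ltNge alpha0.
apply/eqP; rewrite eq_le measure_ge0 andbT.
apply: (@cvge_to_ge _ \oo _ _
  (fun k => ((s%:R / alpha) *+ 2 * (s%:R / p%:R) ^+ k)%:E)); last first.
  by apply: nearW => k; exact: level_measure_le.
apply: cvg_EFin; first exact: nearW.
rewrite -[0](mulr0 ((s%:R / alpha) *+ 2)).
apply: cvgM; first exact: cvg_cst.
apply: cvg_expr; rewrite ger0_norm ?divr_ge0 ?ler0n//.
by rewrite ltr_pdivrMr// mul1r ltr_nat.
Qed.

End LevelSets.

(** * Block sums as integrals of step functions, and their limit *)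

Lemma integral_step (R : realType) (N : R) (phi : nat -> R) (m n : nat) :
  0 < N -> (forall i, 0 <= phi i) -> (m <= n)%N ->
  (\int[lebesgue_measure]_(x in `[(m%:R / N)%R, (n%:R / N)%R[)
    (phi (Num.truncn (N * x)%R))%:E)%E = (\sum_(m <= i < n) phi i / N)%:E.
Proof.
move=> N0 phi0; elim: n => [|n IH].
  by rewrite leqn0 => /eqP ->; rewrite set_itvco0 integral_set0 big_geq.
rewrite leq_eqVlt ltnS => /predU1P[<-|mn].
  by rewrite set_itvco0 integral_set0 big_geq.
have mN : measurable_fun [set: R] (fun x : R => N * x).
  by apply: measurable_funM => //; exact: measurable_cst.
have mphi : measurable_fun [set: R]
    (fun x : R => (phi (Num.truncn (N * x)))%:E : \bar R).
  apply/measurable_EFinP.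
  exact: (measurableT_comp (measurable_fun_truncn phi) mN).
(* The last cell, from [n / N] to [(n+1) / N], is split off: its length is [1 / N] and the integrand
   equals [phi n] on it. *)
rewrite (@itv_bndbnd_setU _ _ _ (BLeft (n%:R / N))); last 2 first.
- by rewrite bnd_simp ler_pM2r ?invr_gt0// ler_nat.
- by rewrite bnd_simp ler_pM2r ?invr_gt0// ler_nat.
rewrite ge0_integral_setU//=; last 3 first.
- exact: measurable_funTS.
- by move=> x _; rewrite lee_fin.
- rewrite disj_set2E; apply/eqP/seteqP; split=> // x /=.
  by rewrite !in_itv/= => -[/andP[_ +] /andP[+ _]] => /lt_le_trans/[apply]; rewrite ltxx.
rewrite IH// big_nat_recr//= EFinD; congr (_ + _)%E.
rewrite (eq_integral (cst (phi n)%:E)).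
  rewrite integral_cst; last exact: measurable_itv.
  rewrite [X in (_ * X)%E](_ : _ = (N^-1)%:E) -?EFinM//.
  etransitivity; first exact: lebesgue_measure_itv.
  rewrite /= lte_fin ltr_pM2r ?invr_gt0// ltr_nat ltnSn.
  by rewrite -EFinD -mulrBl -natrB// subSnn mul1r.
move=> x; rewrite inE/= in_itv/= => /andP[nx xn].
congr (phi _)%:E; apply: truncn_def.
by rewrite mulrC -ler_pdivrMr// nx -ltr_pdivlMr.
Qed.

Lemma cvg_powR (R : realType) (T : Type) (F : set_system T) {FF : Filter F}
    (f : T -> R) (x r : R) : 0 < x ->
  f t @[t --> F] --> x -> f t `^ r @[t --> F] --> x `^ r.
Proof.
move=> x0 fx; have cont : {for x, continuous (fun y : R => y `^ r)}.
  apply: differentiable_continuous; apply/derivable1_diffP.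
  by apply: derivable_powR; rewrite in_itv/= x0.
exact: (cvg_comp _ _ fx cont).
Qed.

Lemma cvg_truncn_scale (R : realType) (s : nat) (x : R) : (2 <= s)%N -> 0 <= x ->
  (Num.truncn (s%:R ^+ k * x))%:R / s%:R ^+ k @[k --> \oo] --> x.
Proof.
move=> hs x0; have s0 : 0 < s%:R :> R by rewrite ltr0n ltnW.
apply: (@squeeze_cvgr _ _ _ _ (fun k => x - s%:R^-1 ^+ k) (fun=> x)).
- apply: nearW => k; have sk0 : 0 < s%:R ^+ k :> R by rewrite exprn_gt0.
  have /andP[tx xt] := truncn_itv (mulr_ge0 (ltW sk0) x0).
  rewrite ler_pdivrMr// [x * _]mulrC tx andbT ler_pdivlMr// mulrBl exprVn.
  by rewrite mulVf ?gt_eqF// lerBlDr mulrC natr1 ltW.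
- rewrite -[X in _ --> X]subr0; apply: cvgB; first exact: cvg_cst.
  apply: cvg_expr; rewrite ger0_norm ?invr_ge0 ?ler0n//.
  by rewrite invf_lt1// ltr1n.
- exact: cvg_cst.
Qed.

Section BlockSums.
Variables (R : realType) (p s : nat) (A : {set 'I_p}).
Hypotheses (hs : (2 <= s)%N) (hsp : (s < p)%N) (hA : #|A| = s).
Variable alpha : R.

Local Notation theta := (expo p s R).
Local Notation lam := (lambda p s A R).
Local Notation b := (Defs.bseq p s A R).
Local Notation D := (`[s%:R^-1, 1[%classic : set R).
Local Notation weight n := (if b n <= alpha then n%:R^-1 else 0 : R).
(** The factor [s^(k+1)] compensates the length of a cell, so that the integral over [D] is the
    unscaled block sum. *)
Local Notation step k x :=
  (s%:R ^+ k.+1 * weight (Num.truncn (s%:R ^+ k.+1 * x))).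

Let s0 : 0 < s%:R :> R. Proof. by rewrite ltr0n ltnW. Qed.
Let p0 : 0 < p%:R :> R. Proof. by rewrite ltr0n (leq_ltn_trans _ hsp). Qed.

(** [lambda] divides by a power of [s^k * x], [bseq] by the same power of its integer part; the
    quotient of the two powers tends to 1. *)
Lemma cvg_bseq_truncn (x : R) : s%:R^-1 <= x ->
  b (Num.truncn (s%:R ^+ k * x)) @[k --> \oo] --> lam x.
Proof.
move=> sx; have x0 : 0 < x by rewrite (lt_le_trans _ sx)// invr_gt0.
have xt0 : x `^ theta != 0 by rewrite gt_eqF ?powR_gt0.
have c1 := cvg_lambda hs hsp hA sx.
have c2 : ((Num.truncn (s%:R ^+ k * x))%:R / s%:R ^+ k) `^ theta
    @[k --> \oo] --> x `^ theta.
  by apply: cvg_powR => //; apply: cvg_truncn_scale => //; exact: ltW.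
rewrite (_ : lam x = lam x * (x `^ theta / x `^ theta)); last first.
  by rewrite divff ?mulr1.
apply: cvg_trans (cvgM c1 (cvgM (cvg_cst (x `^ theta)) (cvgV xt0 c2))).
apply: near_eq_cvg; apply: nearW => k /=; rewrite /Defs.bseq.
set n := Num.truncn _.
have sk0 : 0 < s%:R ^+ k :> R by rewrite exprn_gt0.
have pk0 : p%:R ^+ k != 0 :> R by rewrite gt_eqF ?exprn_gt0.
have -> : n%:R `^ theta = p%:R ^+ k * (n%:R / s%:R ^+ k) `^ theta.
  rewrite -(powR_scale hs hsp) ?divr_ge0 ?ler0n ?(ltW sk0)//.
  by rewrite [s%:R ^+ k * _]mulrC divfK ?gt_eqF.
by rewrite (powR_scale hs hsp) ?ltW// !invfM -!mulrA mulKf.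
Qed.

(** If [lam x] differs from [alpha], the values of [b] end up strictly on one side of [alpha] and
    the test in [weight] stabilises. On the level set nothing forces it to settle. *)
Lemma cvg_step (x : R) : s%:R^-1 <= x -> lam x != alpha ->
  step k x @[k --> \oo] --> if lam x <= alpha then x^-1 else 0.
Proof.
move=> sx lx; have x0 : 0 < x by rewrite (lt_le_trans _ sx)// invr_gt0.
have cb : b (Num.truncn (s%:R ^+ k.+1 * x)) @[k --> \oo] --> lam x.
  have := cvg_bseq_truncn sx.
  by rewrite -(cvg_shiftS (fun k => b (Num.truncn (s%:R ^+ k * x)))).
have cx : s%:R ^+ k.+1 * (Num.truncn (s%:R ^+ k.+1 * x))%:R^-1 @[k --> \oo]
    --> x^-1.
  have := cvg_truncn_scale hs (ltW x0).
  rewrite -cvg_shiftS => cx; apply: cvg_trans (cvgV _ cx); last by rewrite gt_eqF.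
  by apply: near_eq_cvg; apply: nearW => k; rewrite /= invf_div.
have [lxa|alx] := leP (lam x) alpha.
  have {lx lxa} lxa : lam x < alpha by rewrite lt_neqAle lx.
  apply: cvg_trans cx; apply: near_eq_cvg.
  near=> k; rewrite ifT//; apply: ltW; near: k; exact: (cvgr_lt _ cb _ lxa).
apply: cvg_near_cst.
near=> k; rewrite ifF ?mulr0//; apply/negbTE; rewrite -ltNge.
near: k; exact: (cvgr_gt _ cb _ alx).
Unshelve. all: by end_near. Qed.

Lemma step_ge0 (k : nat) (x : R) : 0 <= step k x.
Proof. by rewrite mulr_ge0 ?exprn_ge0//; case: ifP => // _; rewrite invr_ge0. Qed.

(** The dominating constant: [s^(k+1) * x] is at least the integer [s^k], hence so is its integer
    part. *)
Lemma step_le (k : nat) (x : R) : s%:R^-1 <= x -> step k x <= s%:R.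
Proof.
move=> sx; case: ifP => _; last by rewrite mulr0.
have sk0 : 0 < s%:R ^+ k :> R by rewrite exprn_gt0.
have : s%:R ^+ k <= (Num.truncn (s%:R ^+ k.+1 * x))%:R :> R.
  have le1 : s%:R ^+ k <= s%:R ^+ k.+1 * x.
    by rewrite exprSr -mulrA ler_peMr ?(ltW sk0)// -ler_pdivrMl// mulr1.
  by rewrite -(natrX _ s k) ler_nat truncn_ge_nat ?natrX// (le_trans (ltW sk0)).
set n := Num.truncn _ => len; have n0 : 0 < n%:R :> R by exact: lt_le_trans len.
by rewrite ler_pdivrMr// exprS ler_pM2l.
Qed.

Lemma integral_step_block (k : nat) :
  (\int[lebesgue_measure]_(x in D) (step k x)%:E)%E =
  (\sum_(s ^ k <= n < s ^ k.+1) weight n)%:E.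
Proof.
have sk0 : 0 < s%:R ^+ k.+1 :> R by rewrite exprn_gt0.
(* Scaling by [s^(k+1)] maps [D] onto the block from [s^k] to [s^(k+1)]. *)
have -> : D = `[((s ^ k)%:R / s%:R ^+ k.+1), ((s ^ k.+1)%:R / s%:R ^+ k.+1)[%classic.
  rewrite !natrX divff ?gt_eqF// exprSr invfM mulrA divff ?mul1r//.
  by rewrite gt_eqF ?exprn_gt0.
have := @integral_step R (s%:R ^+ k.+1) (fun n => s%:R ^+ k.+1 * weight n)
  (s ^ k) (s ^ k.+1) sk0.
rewrite leq_exp2l// => -> //; last first.
  by move=> n; rewrite mulr_ge0 ?(ltW sk0)//; case: ifP => // _; rewrite invr_ge0.
by congr EFin; apply: eq_bigr => n _; rewrite mulrAC divff ?mul1r ?gt_eqF.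
Qed.

End BlockSums.

Lemma cvg_block_sums (R : realType) (p s : nat) (A : {set 'I_p}) (alpha : R) :
  (2 <= s)%N -> (s < p)%N -> #|A| = s ->
  \sum_(s ^ k <= n < s ^ k.+1)
    (if Defs.bseq p s A R n <= alpha then n%:R^-1 else 0) @[k --> \oo] -->
  Rintegral lebesgue_measure (Eset p s A R alpha) (fun x : R => x^-1).
Proof.
move=> hs hsp hA.
set lam := lambda p s A R.
pose D := `[s%:R^-1, 1[%classic : set R.
pose w n : R := if Defs.bseq p s A R n <= alpha then n%:R^-1 else 0.
pose step k (x : R) : R := s%:R ^+ k.+1 * w (Num.truncn (s%:R ^+ k.+1 * x)).
pose E := [set x | lam x <= alpha].
have ED : Eset p s A R alpha = D `&` E.
  apply/seteqP; split=> x; rewrite /Eset /D /= in_itv/=.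
    by move=> [-> [-> ?]].
  by move=> [/andP[-> ->] ?].
have mD : measurable D by exact: measurable_itv.
have mDE : measurable (D `&` E).
  by rewrite -ED; exact: measurable_Eset.
have x0 x : D x -> 0 < x.
  rewrite /D /= in_itv/= => /andP[sx _]; apply: lt_le_trans sx.
  by rewrite invr_gt0 ltr0n ltnW.
have mstep k : measurable_fun D (EFin \o step k).
  apply/measurable_EFinP; apply: measurable_funTS.
  apply: measurable_funM; first exact: measurable_cst.
  have mk : measurable_fun [set: R] (fun x : R => s%:R ^+ k.+1 * x).
    by apply: measurable_funM => //; exact: measurable_cst.
  exact: (measurableT_comp (measurable_fun_truncn w) mk).
have minv : measurable_fun D (fun x : R => (x^-1)%:E).
  apply/measurable_EFinP.
  apply: (eq_measurable_fun (fun x : R => x `^ (-1))).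
    by move=> x; rewrite inE => /x0/ltW xx; rewrite powR_inv1.
  by apply: measurable_funTS; exact: measurable_powR.
pose f := (fun x : R => (x^-1)%:E) \_ (D `&` E).
have mf : measurable_fun D f.
  apply/measurable_restrict => //.
  by apply: measurable_funS minv => // x [].
have fE x : D x -> f x = (if lam x <= alpha then x^-1 else 0)%:E.
  move=> Dx; rewrite /f patchE; case: ifPn => lx.
    by move: lx; rewrite inE => -[_ ->].
  by rewrite ifF//; apply/negbTE; apply: contraNN lx => lx; rewrite inE.
(* The exceptional set is the level set of [alpha]. *)
have stepf : {ae lebesgue_measure, forall x, D x ->
    (EFin \o step k) x @[k --> \oo] --> f x}.
  exists (D `&` lam @^-1` [set alpha]); split.
  - exact: measurable_level.
  - exact: level_null.
  - move=> x /= /not_implyP[Dx ncv]; split=> //; apply: contrapT => /eqP lx.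
    apply: ncv; rewrite fE//; apply: cvg_EFin; first exact: nearW.
    by apply: cvg_step => //; move: Dx; rewrite /D /= in_itv/= => /andP[].
have ig : lebesgue_measure.-integrable D (EFin \o cst s%:R).
  apply/integrableP; split; first exact/measurable_EFinP/measurable_cst.
  rewrite (eq_integral (cst (s%:R : R)%:E)); last first.
    by move=> x _ /=; rewrite ger0_norm.
  rewrite integral_cst//.
  rewrite [X in (_ * X)%E](_ : _ = (1 - s%:R^-1)%:E) ?ltry//.
  etransitivity; first exact: lebesgue_measure_itv.
  by rewrite /= lte_fin invf_lt1 ?ltr0n ?(ltnW hs)// ltr1n hs.
have dom : {ae lebesgue_measure, forall x k, D x ->
    (`|(EFin \o step k) x| <= (EFin \o cst s%:R) x)%E}.
  apply: aeW => x k Dx /=; rewrite lee_fin ger0_norm ?step_ge0//.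
  by apply: step_le => //; move: Dx; rewrite /D /= in_itv/= => /andP[].
have [intf _ cv] := dominated_convergence (mu := lebesgue_measure) mD
  mstep mf stepf ig dom.
rewrite /Rintegral ED.
have -> : (\int[lebesgue_measure]_(x in D `&` E) (x^-1)%:E)%E =
    (\int[lebesgue_measure]_(x in D) f x)%E.
  by rewrite -[in LHS](setIidr (@subIsetl _ D E)) integral_mkcondr.
set I := (X in fine X).
(* Dominated convergence is stated in the extended reals; integrability of [f] makes [I] finite, so
   the limit descends to the reals. *)
suff cvI : (\sum_(s ^ k <= n < s ^ k.+1) w n)%:E @[k --> \oo] --> (fine I)%:E.
  exact: (fine_cvg cvI).
rewrite fineK ?integrable_fin_num//.
apply: cvg_trans cv; apply: near_eq_cvg; apply: nearW => k /=.
exact: integral_step_block.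
Qed.

(** * From block sums to the logarithmic mean *)

Lemma cvg_log_average (R : realType) (s : nat) (w : nat -> R) (J : R) :
  (2 <= s)%N -> (forall n, 0 <= w n) ->
  \sum_(s ^ k <= n < s ^ k.+1) w n @[k --> \oo] --> J ->
  (ln x)^-1 * \sum_(1 <= n < (Num.truncn x).+1) w n @[x --> +oo] -->
    (ln s%:R)^-1 * J.
Proof.
move=> hs w0 cvB; set B := fun k => _ in cvB.
have s1 : 1 < s%:R :> R by rewrite ltr1n.
have lns : 0 < ln (s%:R : R) by exact: ln_gt0.
(* The sum stops just before [s ^ K], so it consists of exactly the first [K] blocks and
   [C K.+1 / K.+1] is a Cesaro mean of the block sums. *)
pose C K := \sum_(1 <= n < s ^ K) w n.
pose K (x : R) := trunc_log s (Num.truncn x).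
have pos k : (0 < s ^ k)%N by rewrite expn_gt0 ltnW.
have C_series k : C k = series B k.
  elim: k => [|k IH]; first by rewrite /C expn0 big_geq// /series /= big_geq.
  rewrite seriesSr -IH /C /B -big_cat_nat ?leq_exp2l//; exact: pos.
have C_ge0 k : 0 <= C k by apply: sumr_ge0.
have homoT m n : (m <= n)%N -> \sum_(1 <= i < m) w i <= \sum_(1 <= i < n) w i.
  move=> mn; have [m0|m0] := posnP m.
    by rewrite m0 big_geq//; apply: sumr_ge0.
  by rewrite (big_cat_nat m0 mn)/= lerDl; apply: sumr_ge0.
have K_cvg : K x @[x --> +oo] --> \oo.
  apply/cvgnyPge => N; near=> x; apply: trunc_log_max => //.
  rewrite truncn_ge_nat; last by near: x; exact: nbhs_pinfty_ge.
  by near: x; exact: nbhs_pinfty_ge.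
have cvM : C k.+1 / k.+1%:R @[k --> \oo] --> J.
  have := cesaro cvB; rewrite /arithmetic_mean; apply: cvg_trans.
  by apply: near_eq_cvg; apply: nearW => k /=; rewrite C_series mulrC.
(* For [s ^ K <= x < s ^ K.+1] the sum lies between [C K] and [C K.+1], and
   [ln x] between [K * ln s] and [K.+1 * ln s]. *)
have cvL : C k / k.+1%:R @[k --> \oo] --> J.
  (* [C k] differs from [C k.+1] by the single block [B k], which is bounded and so negligible after
     division by [k.+1]. *)
  rewrite -[J]subr0 -[X in _ - X](mulr0 J).
  apply: cvg_trans (cvgB cvM (cvgM cvB (@cvg_harmonic R))).
  apply: near_eq_cvg; apply: nearW => k /=.
  by rewrite !fctE /harmonic /= !C_series seriesSr mulrDl addrK.
have cvU : C k.+1 / k%:R @[k --> \oo] --> J.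
  (* The shift steps past the division by zero at [k = 0]; then the Cesaro mean is corrected by the
     factor [(k+2) / (k+1)], which tends to 1. *)
  rewrite -cvg_shiftS /= (_ : J = J * (1 + 0)); last by rewrite addr0 mulr1.
  have cvM' : C k.+2 / k.+2%:R @[k --> \oo] --> J.
    by rewrite -(cvg_shiftS (fun k => C k.+1 / k.+1%:R)) in cvM.
  have cv1 : 1 + k.+1%:R^-1 @[k --> \oo] --> (1 + 0 : R).
    by apply: cvgD; [exact: cvg_cst|exact: cvg_harmonic].
  apply: cvg_trans (cvgM cvM' cv1).
  apply: near_eq_cvg; apply: nearW => k /=.
  have k1 : k.+1%:R != 0 :> R by rewrite pnatr_eq0.
  rewrite /= -mulrA; congr (_ * _).
  have -> : 1 + k.+1%:R^-1 = k.+2%:R / k.+1%:R :> R.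
    by rewrite -[k.+2%:R]natr1 mulrDl divff// mul1r.
  by rewrite mulKf// pnatr_eq0.
apply: (@squeeze_cvgr _ _ _ _
  (fun x => (ln s%:R)^-1 * (C (K x) / (K x).+1%:R))
  (fun x => (ln s%:R)^-1 * (C (K x).+1 / (K x)%:R))); last 2 first.
- by apply: cvgM; [exact: cvg_cst|exact: (cvg_comp _ _ K_cvg cvL)].
- by apply: cvgM; [exact: cvg_cst|exact: (cvg_comp _ _ K_cvg cvU)].
near=> x.
have sx : s%:R <= x by near: x; exact: nbhs_pinfty_ge.
have x1 : 1 < x by exact: lt_le_trans sx.
have x0 : 0 < x by exact: lt_trans x1.
have lnx : 0 < ln x by exact: ln_gt0.
have tx0 : (0 < Num.truncn x)%N by rewrite truncn_gt0 ltW.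
have /andP[Kx xK] := trunc_log_bounds hs tx0.
(* Since [x >= s], the lower bound [K x * ln s] of [ln x] is positive and can be inverted in the
   upper estimate. *)
have K1 : (0 < K x)%N.
  by apply: trunc_log_max => //; rewrite expn1 truncn_ge_nat ?ltW.
have ln1 : (K x)%:R * ln s%:R <= ln x.
  rewrite mulr_natl -lnXn ?(lt_trans ltr01)//.
  rewrite ler_ln ?posrE ?exprn_gt0 ?(lt_trans ltr01)//.
  by rewrite -natrX -truncn_ge_nat// ltW.
have ln2 : ln x <= (K x).+1%:R * ln s%:R.
  rewrite mulr_natl -lnXn ?(lt_trans ltr01)//.
  rewrite ler_ln ?posrE ?exprn_gt0 ?(lt_trans ltr01)//.
  by rewrite -natrX ltW// -truncn_lt_nat// ltW.
rewrite !mulrA ![_^-1 * C _]mulrC -!mulrA -!invfM.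
rewrite [(ln x)^-1 * _]mulrC; apply/andP; split.
  apply: ler_pM => //; first by rewrite invr_ge0 mulr_ge0// ltW.
    by apply: homoT; rewrite ltnW.
  by rewrite lef_pV2 ?posrE ?mulr_gt0 ?ltr0n// mulrC.
apply: ler_pM => //; first by apply: sumr_ge0.
- by rewrite invr_ge0 ltW.
- exact: homoT.
- by rewrite lef_pV2 ?posrE ?mulr_gt0 ?ltr0n// mulrC.
Unshelve. all: by end_near. Qed.

Theorem theorem4 (R : realType) (p s : nat) (A : {set 'I_p})
  (hp : (3 <= p)%N) (hs : (2 <= s)%N) (hsp : (s < p)%N) (hA : #|A| = s)
  (alpha : R) :
  m_inf p s A R <= alpha <= M_sup p s A R ->
  measurable (Eset p s A R alpha) /\
  (partialL p s A R alpha x @[x --> +oo] -->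
     (ln (s%:R : R))^-1 *
       Rintegral lebesgue_measure (Eset p s A R alpha) (fun x : R => x^-1)).
Proof.
move=> _; split; first exact: measurable_Eset.
(* Moving the condition into the summand turns the filtered sum into a full sum of nonnegative
   weights. *)
rewrite /partialL; under eq_fun do rewrite big_mkcond.
apply: cvg_log_average => //; last exact: cvg_block_sums.
by move=> n; case: ifP => // _; rewrite invr_ge0.
Qed.
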